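(* Let $P=(X,\prec_P)$ and $Q=(Y,\prec_Q)$ be finite posets, and suppose $x$ is a minimal element of $P$ and $y$ is a minimal element of $Q$. Then there is a finite poset $R$ and an element $z\in R$ with $$|R|=|P|+|Q|-1\qquad\text{and}\qquad \rho(R,z)=\rho(P,x)+\rho(Q,y)-1.$$
   Context: For a finite poset $P$, $e(P)$ denotes the number of linear extensions of $P$, with the convention $e(\varnothing)=1$. For $x\in P$, $P-x$ is the induced subposet on $P\setminus\{x\}$, and $\rho(P,x):=e(P)/e(P-x)$ (a rational number). $|P|$ is the number of elements of $P$. *)

(* Defs.v *)
From HB Require Import structures.
From mathcomp Require Import all_boot all_order all_algebra.

Set Implicit Arguments.
Unset Strict Implicit.
Unset Printing Implicit Defensive.

Import Order.TTheory GRing.Theory Num.Theory.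

(* Linear extensions as order-preserving bijections onto {0, ..., #|P| - 1};
   injectivity suffices, since domain and codomain have the same cardinality. *)
Definition is_linext (d : Order.disp_t) (P : finPOrderType d)
    (f : {ffun P -> 'I_#|P|}) : bool :=
  injectiveb f && [forall u, forall v, (u < v)%O ==> (f u < f v)%N].

Definition num_linext (d : Order.disp_t) (P : finPOrderType d) : nat :=
  #|[set f : {ffun P -> 'I_#|P|} | is_linext f]|.

Record poset_del (d : Order.disp_t) (P : finPOrderType d) (x : P) : Type :=
  PosetDel { del_val : P; _ : del_val != x }.

HB.instance Definition _ (d : Order.disp_t) (P : finPOrderType d) (x : P) :=
  [isSub for @del_val d P x].
HB.instance Definition _ (d : Order.disp_t) (P : finPOrderType d) (x : P) :=
  [Finite of poset_del x by <:].
HB.instance Definition _ (d : Order.disp_t) (P : finPOrderType d) (x : P) :=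
  [SubChoice_isSubPOrder of poset_del x by <: with d].

Definition is_minimal (d : Order.disp_t) (P : finPOrderType d) (x : P) : Prop :=
  forall u : P, ~~ (u < x)%O.

Definition rho (d : Order.disp_t) (P : finPOrderType d) (x : P) : rat :=
  ((num_linext P)%:R / (num_linext (poset_del x))%:R)%R.

Lemma num_linext_empty (d : Order.disp_t) (P : finPOrderType d) :
  #|P| = 0 -> num_linext P = 1.
Proof.
move=> P0; have noP (u : P) : False by have := fintype0 u P0.
rewrite /num_linext -[RHS]/(0 ^ 0).
have -> : [set f : {ffun P -> 'I_#|P|} | is_linext f] = setT.
  apply/setP=> f; rewrite !inE; apply/andP; split; first by apply/injectiveP=> u.
  by apply/forallP=> u; case: (noP u).
by rewrite cardsT card_ffun card_ord P0.
Qed.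

(* Main.v *)
(** Put the dual of [P - x] entirely below [Q - y] and insert a new element [z]
    above the elements that [P] has over [x] and below the elements that [Q] has
    over [y].  A linear extension of the resulting poset cannot place [z] both
    below some element of [P - x] and above some element of [Q - y].  The
    extensions with [z] below all of [Q - y] are those of the linear sum
    P^* + (Q - y), the extensions with [z] above all of [P - x] are those of
    (P - x)^* + Q, and those of both kinds are the extensions of
    (P - x)^* + (one point) + (Q - y), so inclusion-exclusion gives
    e(R) = e(P) e(Q - y) + e(P - x) e(Q) - e(P - x) e(Q - y). *)
From HB Require Import structures.
Require Import Defs.
From mathcomp Require Import all_boot all_order all_algebra.
From mathcomp Require Import ring.

Set Implicit Arguments.
Unset Strict Implicit.
Unset Printing Implicit Defensive.

Import Order.TTheory GRing.Theory Num.Theory.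

(** * Linear extensions of bare relations: transport and duality *)

(** No order axioms are imposed on [r], so duals, sums and extra constraints need no new poset
    instances. With [n] equal to [#|P|] and [r] the strict order, its cardinal is [num_linext P] by
    conversion. *)
Definition linexts (T : finType) (n : nat) (r : rel T) : {set {ffun T -> 'I_n}} :=
  [set f : {ffun T -> 'I_n} | injectiveb f && [forall u, forall v, r u v ==> (f u < f v)%N]].

Lemma linextsP (T : finType) (n : nat) (r : rel T) (f : {ffun T -> 'I_n}) :
  reflect (injective f /\ forall u v, r u v -> (f u < f v)%N)
          (f \in linexts n r).
Proof.
rewrite inE; apply: (iffP andP) => -[If mf]; split.
- exact/injectiveP.
- by move=> u v ruv; move/forallP/(_ u)/forallP/(_ v)/implyP: mf; apply.
- exact/injectiveP.
- by apply/forallP=> u; apply/forallP=> v; apply/implyP; apply: mf.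
Qed.

(** Precomposition with [g] loses no information since [g] is onto, and preserves injectivity of
    extensions since [g] is one-to-one. *)
Lemma card_linexts_le_pull (T T' : finType) (n : nat) (r : rel T) (r' : rel T')
    (g : T -> T') :
    bijective g -> (forall u v, r u v -> r' (g u) (g v)) ->
  #|linexts n r'| <= #|linexts n r|.
Proof.
move=> [h gK hK] gr; pose phi (f : {ffun T' -> 'I_n}) := [ffun u => f (g u)].
have phi_inj : injective phi.
  move=> f1 f2 /ffunP e; apply/ffunP=> u.
  by have := e (h u); rewrite !ffunE hK.
rewrite -(card_imset _ phi_inj); apply: subset_leq_card.
apply/subsetP=> _ /imsetP[f /linextsP[If mf] ->]; apply/linextsP; split.
  by move=> u v; rewrite !ffunE => /If; apply: can_inj gK _ _.
by move=> u v ruv; rewrite !ffunE mf ?gr.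
Qed.

Lemma card_linexts_iso (T T' : finType) (n : nat) (r : rel T) (r' : rel T')
    (g : T -> T') :
    bijective g -> (forall u v, r u v = r' (g u) (g v)) ->
  #|linexts n r'| = #|linexts n r|.
Proof.
move=> g_bij gr; apply/eqP; rewrite eqn_leq.
rewrite (@card_linexts_le_pull _ _ _ _ _ g) => // [|u v]; last by rewrite gr.
case: g_bij => h gK hK; apply: (@card_linexts_le_pull _ _ _ _ _ h).
  by exists g.
by move=> u v ruv; rewrite gr !hK.
Qed.

Lemma card_linexts_dual (T : finType) (n : nat) (r : rel T) :
  #|linexts n (fun u v => r v u)| = #|linexts n r|.
Proof.
(* Dualizing twice gives back the relation by conversion, so one inequality suffices; it comes from
   reversing the values. *)
suff le r' : #|linexts n r'| <= #|linexts n (fun u v : T => r' v u)|.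
  by apply/eqP; rewrite eqn_leq; apply/andP; split; apply: le.
pose phi (f : {ffun T -> 'I_n}) := [ffun u => rev_ord (f u)].
have phi_inj : injective phi.
  move=> f1 f2 /ffunP e; apply/ffunP=> u; apply: rev_ord_inj.
  by have := e u; rewrite !ffunE.
rewrite -(card_imset _ phi_inj); apply: subset_leq_card.
apply/subsetP=> _ /imsetP[f /linextsP[If mf] ->]; apply/linextsP; split.
  by move=> u v; rewrite !ffunE => /rev_ord_inj/If.
by move=> u v /mf lt; rewrite !ffunE /= ltn_sub2l // (leq_ltn_trans lt).
Qed.

(** * Extensions of a linear sum *)

Lemma card_le_of_inj_lt (T : finType) (n m : nat) (g : T -> 'I_n) :
  injective g -> (forall t, g t < m) -> #|T| <= m.
Proof.
move=> Ig lt; rewrite -[m]card_ord.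
apply: (@leq_card _ _ (fun t => Ordinal (lt t))) => s t [e].
by apply: Ig; apply: val_inj.
Qed.

Lemma card_le_of_inj_ge (T : finType) (n m : nat) (g : T -> 'I_n) :
  injective g -> (forall t, m <= g t) -> #|T| <= n - m.
Proof.
move=> Ig le.
apply: (@card_le_of_inj_lt T n (n - m) (fun t => rev_ord (g t))).
  by move=> s t /rev_ord_inj/Ig.
move=> t /=; have := le t; have := ltn_ord (g t).
by move=> gn mg; rewrite ltn_sub2l ?ltnS // (leq_ltn_trans mg).
Qed.

Definition sum_rel (T1 T2 : Type) (r1 : rel T1) (r2 : rel T2) : rel (T1 + T2) :=
  fun u v => match u, v with
  | inl a, inl b => r1 a b
  | inl _, inr _ => true
  | inr _, inl _ => false
  | inr a, inr b => r2 a b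
  end.

(** Counting forces the lower part onto exactly the first [#|T1|] values, so each extension is a
    pair of extensions glued by [phi]. *)
Lemma card_linexts_sum (T1 T2 : finType) (r1 : rel T1) (r2 : rel T2) :
  #|linexts (#|T1| + #|T2|) (sum_rel r1 r2)| =
  #|linexts #|T1| r1| * #|linexts #|T2| r2|.
Proof.
set n1 := #|T1|; set n2 := #|T2|.
pose phi (F : {ffun T1 -> 'I_n1} * {ffun T2 -> 'I_n2}) :
    {ffun T1 + T2 -> 'I_(n1 + n2)} :=
  [ffun u : T1 + T2 => match u with
     | inl a => lshift n2 (F.1 a) | inr b => rshift n1 (F.2 b) end].
have phi_inj : injective phi.
  move=> [f1 f2] [g1 g2] /ffunP e; congr (_, _); apply/ffunP=> u.
    by have := e (inl u); rewrite !ffunE => /lshift_inj.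
  by have := e (inr u); rewrite !ffunE => /rshift_inj.
rewrite -cardsX -(card_imset _ phi_inj); apply: eq_card => f.
apply/linextsP/imsetP => [[If mf]|[[f1 f2]]]; last first.
  rewrite in_setX => /andP[/linextsP[I1 m1] /linextsP[I2 m2]] ->; split.
    move=> [u|u] [v|v]; rewrite !ffunE /=.
    - by move=> /lshift_inj/I1 ->.
    - by move=> /eqP; rewrite eq_lrshift.
    - by move=> /eqP; rewrite eq_rlshift.
    - by move=> /rshift_inj/I2 ->.
  move=> [u|u] [v|v] //= ruv; rewrite !ffunE /=.
  - exact: m1.
  - by rewrite (leq_trans (ltn_ord _)) ?leq_addr.
  - by rewrite ltn_add2l m2.
(* The [n2] images of the upper part all exceed [f (inl a)], and the [n1]
   images of the lower part all lie below [f (inr b)]. *)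
have lo a : f (inl a) < n1.
  have := @card_le_of_inj_ge _ _ (f (inl a)).+1 (fun b => f (inr b)).
  have -> : (n1 + n2 - (f (inl a)).+1 >= #|T2|) = (f (inl a) < n1).
    rewrite leq_subRL ?ltn_ord // -/n2.
    by rewrite leq_add2r.
  apply=> [b c /If[]//|b]; exact: mf.
have hi b : n1 <= f (inr b).
  by apply: (@card_le_of_inj_lt _ _ _ (fun a => f (inl a))) => [a c /If[]|a];
    [|apply: mf].
have hi' b : f (inr b) - n1 < n2 by rewrite ltn_subLR ?ltn_ord.
exists ([ffun a => Ordinal (lo a)], [ffun b => Ordinal (hi' b)]).
  rewrite in_setX; apply/andP; split; apply/linextsP; split=> u v; rewrite !ffunE.
  - by move=> [] /val_inj/If[].
  - by move=> ruv /=; apply: mf.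
  - move=> [] /eqP; rewrite -(eqn_add2r n1) !subnK // => /eqP /val_inj/If[] //.
  - by move=> ruv /=; rewrite ltn_sub2rE //; apply: mf.
apply/ffunP=> -[u|u]; rewrite !ffunE; apply: val_inj => //=.
by rewrite subnKC.
Qed.

Lemma card_linexts_unit (r : rel unit) :
  irreflexive r -> #|linexts #|{: unit}| r| = 1.
Proof.
move=> r_irr; rewrite card_unit; apply/eqP/cards1P; exists [ffun=> ord0].
apply/setP=> f; rewrite inE; apply/linextsP/eqP => [_|->].
  by apply/ffunP=> u; rewrite ffunE ord1.
by split=> [[] []|[] []] //; rewrite r_irr.
Qed.

(** * Existence of a linear extension, so that the denominators of [rho] are nonzero *)

Lemma num_linext_gt0 (d : Order.disp_t) (P : finPOrderType d) : 0 < num_linext P.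
Proof.
apply/card_gt0P.
(* Two digits in base [#|P|]: the number of strict predecessors, with ties broken by [enum_rank]. *)
pose key (u : P) := (#|[set v : P | (v < u)%O]| * #|P| + enum_rank u)%N.
have key_inj : injective key.
  move=> u v /(congr1 (modn^~ #|P|)).
  by rewrite !modnMDl !modn_small ?ltn_ord // => /val_inj/enum_rank_inj.
have key_lt u v : (u < v)%O -> key u < key v.
  move=> uv; have : #|[set w : P | (w < u)%O]| < #|[set w : P | (w < v)%O]|.
    apply: proper_card; apply/properP; split.
      by apply/subsetP=> w; rewrite !inE => /lt_trans; apply.
    by exists u; rewrite !inE ?ltxx.
  have P_gt0 : 0 < #|P| by apply/card_gt0P; exists u.
  rewrite -(leq_pmul2r P_gt0).
  rewrite mulSn => le; apply: leq_trans (leq_trans le (leq_addr _ _)).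
  by rewrite addnC ltn_add2l.
(* Ranking the keys compresses them into the range below [#|P|]. *)
pose below (u : P) := [set w | key w < key u].
have below_lt u v : key u < key v -> #|below u| < #|below v|.
  move=> uv; apply: proper_card; apply/properP; split.
    by apply/subsetP=> w; rewrite !inE => /ltn_trans; apply.
  by exists u; rewrite !inE ?ltnn.
have below_card u : #|below u| < #|P|.
  rewrite -cardsT; apply: proper_card; apply/properP; split; first exact: subsetT.
  by exists u; rewrite !inE ?ltnn.
exists [ffun u : P => Ordinal (below_card u)].
change ([ffun u => Ordinal (below_card u)] \in linexts #|P| <%O).
apply/linextsP; split=> u v; rewrite !ffunE /=.
  move=> [e]; apply: key_inj; case: (ltngtP (key u) (key v)) => // /below_lt.
    by rewrite e ltnn.
  by rewrite e ltnn.
by move=> /key_lt/below_lt.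
Qed.

(** Lets side conditions on the position of one element be absorbed into the relation, even when the
    union is not given as an order. *)
Lemma linexts_relU (T : finType) (n : nat) (r1 r2 : rel T) :
  linexts n r1 :&: linexts n r2 = linexts n (fun u v => r1 u v || r2 u v).
Proof.
apply/setP=> f; rewrite inE; apply/andP/linextsP.
  by move=> [/linextsP[If m1] /linextsP[_ m2]]; split=> // u v /orP[/m1|/m2].
by move=> [If mf]; split; apply/linextsP; split=> // u v ruv; apply: mf;
  rewrite ruv ?orbT.
Qed.

(** * Rebuilding a poset from the deletion of a minimal element *)

Definition bot_rel (T : Type) (a : pred T) (r : rel T) : rel (option T) :=
  fun u v => match u, v with
  | Some u', Some v' => r u' v'
  | None, Some v' => a v'
  | _, None => false
  end.

Definition undel (d : Order.disp_t) (P : finPOrderType d) (x : P)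
    (o : option (poset_del x)) : P := if o is Some p then val p else x.

Lemma undel_bij (d : Order.disp_t) (P : finPOrderType d) (x : P) :
  bijective (@undel d P x).
Proof.
exists (fun u => insub u) => [[p|]|u] /=; first exact: valK.
  by rewrite insubF ?eqxx.
by case: insubP => [p _ <-|] //=; rewrite negbK => /eqP.
Qed.

Lemma card_poset_del (d : Order.disp_t) (P : finPOrderType d) (x : P) :
  #|P| = #|{: poset_del x}|.+1.
Proof. by rewrite -(bij_eq_card (@undel_bij d P x)) card_option. Qed.

(** [None] stands for [x]; minimality is what matches the absence of elements below [None] in
    [bot_rel]. *)
Lemma num_linext_undel (d : Order.disp_t) (P : finPOrderType d) (x : P) :
    is_minimal x ->
  #|linexts #|{: option (poset_del x)}|
      (bot_rel (fun p : poset_del x => (x < val p)%O) <%O)| = num_linext P.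
Proof.
move=> x_min; rewrite (bij_eq_card (@undel_bij d P x)); symmetry.
apply: (@card_linexts_iso _ _ _ _ _ (@undel d P x)) => [|[p|] [q|]] //=.
- exact: undel_bij.
- by rewrite (negbTE (x_min _)).
Qed.

(** * The spliced poset and its inclusion-exclusion count *)

Section Splice.

Variables (dP dQ : Order.disp_t) (P : finPOrderType dP) (Q : finPOrderType dQ).
Variables (x : P) (y : Q).

Definition splice : Type := option (poset_del x + poset_del y).

HB.instance Definition _ := Finite.on splice.

Definition splice_lt : rel splice := fun u v => match u, v with
  | Some u', Some v' => sum_rel (fun p q => (q < p)%O) <%O u' v'
  | Some (inl p), None => (x < val p)%O
  | None, Some (inr q) => (y < val q)%O
  | _, _ => false
  end.

Lemma splice_lt_irr : irreflexive splice_lt.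
Proof. by move=> [[p|q]|] //=; rewrite ltxx. Qed.

(** A chain through [None] runs from [inl] to [inr], where comparability always holds; chains ending
    or starting at [None] use transitivity in [P] or [Q]. *)
Lemma splice_lt_trans : transitive splice_lt.
Proof.
move=> [[v|v]|] [[u|u]|] [[w|w]|] //=.
- by move=> uv vw; apply: lt_trans vw uv.
- by move=> uv vw; apply: lt_trans vw uv.
- exact: lt_trans.
- exact: lt_trans.
Qed.

HB.instance Definition _ :=
  Order.Lt_isPOrder.Build dP splice splice_lt_irr splice_lt_trans.

Definition below_upper : rel splice := fun u v =>
  if u is None then if v is Some (inr _) then true else false else false.

Definition above_lower : rel splice := fun u v =>
  if v is None then if u is Some (inl _) then true else false else false.

Lemma card_splice : #|{: splice}| = (#|{: poset_del x}| + #|{: poset_del y}|).+1.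
Proof. by rewrite card_option card_sum. Qed.

Let L := linexts #|{: splice}| splice_lt.
Let A := L :&: linexts #|{: splice}| below_upper.
Let B := L :&: linexts #|{: splice}| above_lower.

Lemma linexts_spliceU : L = A :|: B.
Proof.
rewrite -setIUr; apply/esym/setIidPl/subsetP=> f fL; rewrite inE.
have [If mf] := linextsP _ _ fL.
case: (boolP [forall q : poset_del y, f None < f (Some (inr q))]) => [/forallP lo|].
  by apply/orP; left; apply/linextsP; split=> // -[u|] // [[v|q]|] // _.
(* This [q] is not placed above [None], while every [inl p] is placed below [q], hence below
   [None]. *)
rewrite negb_forall => /existsP[q]; rewrite -leqNgt => qz.
apply/orP; right; apply/linextsP; split=> // -[[p|q']|] // [v|] // _.
by rewrite (leq_trans _ qz) // mf.
Qed.

Lemma card_splice_below :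
  is_minimal x -> #|A| = num_linext P * num_linext (poset_del y).
Proof.
move=> x_min; rewrite /A linexts_relU card_splice.
rewrite -(num_linext_undel x_min) -(card_linexts_dual _ (bot_rel _ _)).
rewrite -[num_linext _]/#|linexts #|{: poset_del y}| <%O| -card_linexts_sum.
rewrite card_option addSn.
(* [None] joins the lower block, where it is the top of the dual of [P], in the role of [x]. *)
pose g (u : option (poset_del x) + poset_del y) : splice := match u with
  | inl (Some p) => Some (inl p) | inl None => None | inr q => Some (inr q) end.
apply: (@card_linexts_iso _ _ _ _ _ g).
  exists (fun u : splice => match u with
    | Some (inl p) => inl (Some p) | None => inl None | Some (inr q) => inr q end).
    by move=> [[p|]|q].
  by move=> [[p|q]|].
by move=> [[p|]|q] [[p'|]|q'] //=; rewrite ?orbF ?orbT.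
Qed.

Lemma card_splice_above :
  is_minimal y -> #|B| = num_linext (poset_del x) * num_linext Q.
Proof.
move=> y_min; rewrite /B linexts_relU card_splice.
rewrite -(num_linext_undel y_min).
rewrite -[num_linext _]/#|linexts #|{: poset_del x}| <%O|.
rewrite -(card_linexts_dual _ <%O) -card_linexts_sum card_option addnS.
(* Here [None] joins the upper block instead, in the role of [y]. *)
pose g (u : poset_del x + option (poset_del y)) : splice := match u with
  | inl p => Some (inl p) | inr None => None | inr (Some q) => Some (inr q) end.
apply: (@card_linexts_iso _ _ _ _ _ g).
  exists (fun u : splice => match u with
    | Some (inl p) => inl p | None => inr None | Some (inr q) => inr (Some q) end).
    by move=> [p|[q|]].
  by move=> [[p|q]|].
by move=> [p|[q|]] [p'|[q'|]] //=; rewrite ?orbF ?orbT.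
Qed.

Lemma card_splice_both :
  #|A :&: B| = num_linext (poset_del x) * num_linext (poset_del y).
Proof.
rewrite /A /B -setIIr !linexts_relU card_splice.
rewrite -[num_linext (poset_del x)]/#|linexts #|{: poset_del x}| <%O|.
rewrite -[num_linext (poset_del y)]/#|linexts #|{: poset_del y}| <%O|.
rewrite -(card_linexts_dual _ (<%O : rel (poset_del x))).
(* The factor 1 is the count for a one-point middle block, so that the sum formula applies twice. *)
rewrite -[#|linexts #|_| <%O|]mul1n.
rewrite -(@card_linexts_unit (fun _ _ => false)) // -!card_linexts_sum.
rewrite -card_sum -card_linexts_sum card_sum card_unit addnA addn1 addSn.
pose g (u : poset_del x + (unit + poset_del y)) : splice := match u with
  | inl p => Some (inl p) | inr (inl _) => None | inr (inr q) => Some (inr q) end.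
apply: (@card_linexts_iso _ _ _ _ _ g).
  exists (fun u : splice => match u with
    | Some (inl p) => inl p | None => inr (inl tt) | Some (inr q) => inr (inr q) end).
    by move=> [p|[[]|q]].
  by move=> [[p|q]|].
by move=> [p|[[]|q]] [p'|[[]|q']] //=; rewrite ?orbF ?orbT.
Qed.

(** Inclusion-exclusion for [A] and [B], kept additive to avoid truncated subtraction. *)
Lemma num_linext_splice : is_minimal x -> is_minimal y ->
  num_linext splice + num_linext (poset_del x) * num_linext (poset_del y) =
  num_linext P * num_linext (poset_del y) + num_linext (poset_del x) * num_linext Q.
Proof.
move=> x_min y_min.
rewrite -(card_splice_below x_min) -(card_splice_above y_min) -card_splice_both.
by rewrite -cardsUI -linexts_spliceU.
Qed.

Lemma num_linext_splice_del :
  num_linext (poset_del (None : splice)) =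
  num_linext (poset_del x) * num_linext (poset_del y).
Proof.
rewrite -[num_linext (poset_del x)]/#|linexts #|{: poset_del x}| <%O|.
rewrite -[num_linext (poset_del y)]/#|linexts #|{: poset_del y}| <%O|.
rewrite -(card_linexts_dual _ (<%O : rel (poset_del x))) -card_linexts_sum.
pose g (u : poset_del x + poset_del y) : poset_del (None : splice) :=
  @PosetDel _ splice None (Some u) isT.
(* Injectivity and equal cardinalities spare an explicit inverse. *)
have g_bij : bijective g.
  apply: inj_card_bij => [u v [] //|].
  by rewrite -ltnS -card_poset_del card_splice card_sum.
rewrite -card_sum (bij_eq_card g_bij).
by apply: (card_linexts_iso _ g_bij) => -[p|q] [p'|q']; rewrite -lt_val.
Qed.

End Splice.

Theorem lemma3p1 (dP dQ : Order.disp_t) (P : finPOrderType dP)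
    (Q : finPOrderType dQ) (x : P) (y : Q) :
  is_minimal x -> is_minimal y ->
  exists (dR : Order.disp_t) (R : finPOrderType dR) (z : R),
    #|R| = (#|P| + #|Q| - 1)%N /\ rho z = (rho x + rho y - 1)%R.
Proof.
move=> x_min y_min; exists dP, (splice x y), None; split.
  by rewrite card_splice (card_poset_del x) (card_poset_del y) addnS subn1 addSn.
have := num_linext_splice x_min y_min.
rewrite /rho num_linext_splice_del !natrM.
move=> /(congr1 (fun n => n%:R : rat)%R); rewrite !natrD !natrM => e.
have nz d (S : finPOrderType d) : ((num_linext S)%:R != 0 :> rat)%R.
  by rewrite pnatr_eq0 -lt0n num_linext_gt0.
(* Solved for the count of the splice in [rat]; dividing by the product of the two deletion counts
   gives the two ratios minus 1. *)
move/(canRL (addrK _)): e => ->.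
by field; rewrite !nz.
Qed.
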